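(* Let $b\ge 2$ and $d\ge1$ be integers and let $a_1,\dots,a_d$ be positive integers coprime to $b$. Then \[(I-T^{a_d})\,S_{(a_1,\dots,a_d;b)}=S_{(a_1,\dots,a_{d-1};b)}\] and \[S_{(a_1,\dots,a_d;b)}=S_{(a_1;b)}*S_{(a_2;b)}*\cdots*S_{(a_d;b)}.\]
   Context: For $b\ge2$, $\xi_b=e^{2\pi i/b}$ and positive integers $a_i$ coprime to $b$, the Fourier–Dedekind sum is $S_{(a_1,\dots,a_d;b)}(n)=\frac1b\sum_{j=1}^{b-1}\frac{\xi_b^{jn}}{(1-\xi_b^{ja_1})\cdots(1-\xi_b^{ja_d})}$, a $b$-periodic function of $n\in\mathbb{Z}$; for $d=1$ the right side of the first identity is the $0$-dimensional sum $S_{(\,;b)}(n)=S_b(n):=\frac1b\sum_{j=1}^{b-1}\xi_b^{jn}$. $I$ is the identity operator, $(T^a h)(t)=h(t+a)$, and for $b$-periodic $f,g$, $(f*g)(t)=\sum_{m=0}^{b-1}f(t-m)g(m)$. *)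

(* Defs.v *)
From mathcomp Require Import all_boot all_order all_algebra.
From mathcomp Require Import complex.
From mathcomp Require Import boolp functions reals trigo.

Set Implicit Arguments.
Unset Strict Implicit.
Unset Printing Implicit Defensive.

Import Order.TTheory GRing.Theory Num.Theory.
Local Open Scope ring_scope.

(* e^(i theta), by Euler's formula. *)
Definition expi (R : realType) (theta : R) : R[i] :=
  (cos theta +i* sin theta)%C.

Definition xi (R : realType) (b : nat) : R[i] := expi (2 * pi / b%:R).

(* [a] lists a_1, ..., a_d; the case [a = [::]] is the 0-dimensional sum
   (1/b) sum_j xi_b^(jn), its denominator being the empty product. The integer
   power is needed because n may be negative. *)
Definition fourier_dedekind (R : realType) (a : seq nat) (b : nat) :
    int -> R[i] := fun n =>
  b%:R^-1 * \sum_(1 <= j < b)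
    xi R b ^ (j%:Z * n) / \prod_(ai <- a) (1 - xi R b ^+ (j * ai)).

Definition translate (V : Type) (a : int) (h : int -> V) : int -> V :=
  fun t => h (t + a).

(* Meaningful for b-periodic f and g. *)
Definition conv (V : pzRingType) (b : nat) (f g : int -> V) : int -> V :=
  fun t => \sum_(0 <= m < b) f (t - m%:Z) * g m%:Z.

(* f_1 * f_2 * ... * f_d, associated to the left; the value on the empty list
   is the unit of [conv b] on b-periodic functions. *)
Definition convs (V : pzRingType) (b : nat) (fs : seq (int -> V)) : int -> V :=
  if fs is f :: fs' then foldl (conv b) f fs'
  else fun t => (b%:Z %| t)%Z%:R.

(* Main.v *)
Require Import Defs.
From mathcomp Require Import all_boot all_order all_algebra.
From mathcomp Require Import complex.
From mathcomp Require Import boolp functions reals trigo.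

Import Order.TTheory GRing.Theory Num.Theory.
Local Open Scope ring_scope.

(** For a primitive b-th root of unity z, orthogonality of characters says that
    the sum over m of z^(j(t-m)) z^(km) is b z^(jt) if j = k and 0 otherwise, so
    convolution multiplies Fourier coefficients; those of S_(a_1,...,a_d;b) are
    products of those of the S_(a_i;b).  The operator I - T^a multiplies the
    j-th coefficient by 1 - z^(ja), which is nonzero when a is coprime to b. *)

Lemma expiD {R : realType} (x y : R) : expi (x + y) = expi x * expi y.
Proof.
by rewrite /expi cosD sinD; congr (_ +i* _)%C; rewrite addrC.
Qed.

Lemma expiX {R : realType} (x : R) (n : nat) : expi x ^+ n = expi (x *+ n).
Proof.
elim: n => [|n IHn]; first by rewrite expr0 mulr0n /expi cos0 sin0.
by rewrite exprS IHn mulrS expiD.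
Qed.

(** The real part already differs from 1: cos x = 1 - 2 sin(x/2)^2, and x/2 lies in (0, pi), where
    sin is positive. *)
Lemma expi_neq1 {R : realType} (x : R) : 0 < x < pi *+ 2 -> expi x != 1.
Proof.
move=> /andP[x_gt0 x_lt]; rewrite eq_complex /= negb_and; apply/orP; left.
have x2 : (x / 2) *+ 2 = x by rewrite -mulr_natr divfK ?pnatr_eq0.
have s_gt0 : 0 < sin (x / 2).
  by apply: sin_gt0_pi; rewrite divr_gt0 //= ltr_pdivrMr // mulr_natr.
have /eqP := cos2Dsin2 (x / 2); rewrite eq_sym -subr_eq => /eqP sE.
rewrite -x2 cos_mulr2n -sE lt_eqF // ltrBlDr ltrMn2r /=.
by rewrite ltrBlDr ltrDl exprn_gt0.
Qed.

Lemma xi_prim (R : realType) (b : nat) :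
  (0 < b)%N -> b.-primitive_root (xi R b).
Proof.
move=> b_gt0; rewrite /primitive_root_of_unity b_gt0 /=.
have b_neq0 : b%:R != 0 :> R by rewrite pnatr_eq0 -lt0n.
(* Only exponents [i.+1] from 1 to [b] are tested: the angle is a full turn at [b] and strictly
   between 0 and 2 pi before. *)
apply/forallP => i; apply/eqP; rewrite unity_rootE /xi expiX.
have [->|ltib] := eqVneq i.+1 b.
  rewrite -[_ *+ b]mulr_natr divfK // mulrC mulr_natr.
  by rewrite /expi cos2pi sin2pi eqxx.
apply/negbTE/expi_neq1; rewrite pmulrn_lgt0 //.
rewrite divr_gt0 ?mulr_gt0 ?pi_gt0 ?ltr0n //=.
rewrite -[_ *+ i.+1]mulr_natr mulrAC ltr_pdivrMr ?ltr0n //.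
rewrite -[pi *+ 2]mulr_natl ltr_pM2l ?mulr_gt0 ?pi_gt0 //.
by rewrite ltr_nat ltn_neqAle ltib ltn_ord.
Qed.

Section PrimitiveRoot.
Variables (F : fieldType) (b : nat) (z : F).
Hypothesis z_prim : b.-primitive_root z.

Let b_gt0 : (0 < b)%N := prim_order_gt0 z_prim.

Lemma prim_root_neq0 : z != 0.
Proof.
apply/eqP => z0; have /eqP := prim_expr_order z_prim.
by rewrite z0 expr0n eqn0Ngt b_gt0 eq_sym oner_eq0.
Qed.

Lemma prim_root_orthogonality (j k : nat) (t : int) : (j < b)%N -> (k < b)%N ->
  \sum_(0 <= m < b) z ^ (j%:Z * (t - m%:Z)) * z ^ (k%:Z * m%:Z) =
  if j == k then b%:R * z ^ (j%:Z * t) else 0.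
Proof.
move=> ltjb ltkb; have z0 := prim_root_neq0.
(* With this ratio the sum becomes z^(jt) times a geometric sum in [w]. *)
pose w := z ^+ k / z ^+ j.
have termE m : z ^ (j%:Z * (t - m%:Z)) * z ^ (k%:Z * m%:Z)
    = z ^ (j%:Z * t) * w ^+ m.
  rewrite mulrBr expfzDr // -mulrA; congr (_ * _).
  by rewrite /w exprMn mulrC exprVn -!exprM -exprnN.
under eq_bigr => m _ do rewrite termE.
rewrite -mulr_sumr big_mkord.
have [ejk|neq_jk] := eqVneq j k.
  have -> : w = 1 by rewrite /w ejk divff // expf_neq0.
  under eq_bigr => m _ do rewrite expr1n.
  by rewrite sumr_const card_ord mulrC.
have w_neq1 : w - 1 != 0.
  rewrite subr_eq0 /w; apply: contra neq_jk => /eqP w1.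
  have /eqP : z ^+ k = z ^+ j.
    by rewrite -[LHS](divfK (expf_neq0 j z0)) w1 mul1r.
  by rewrite (eq_prim_root_expr z_prim) !modn_small // eq_sym.
(* The left side vanishes because z^b = 1; as [w - 1] is nonzero, the geometric sum is 0. *)
have /esym/eqP : w ^+ b - 1 = (w - 1) * \sum_(m < b) w ^+ m := subrX1 w b.
rewrite /w exprMn exprVn -!exprM ![(_ * b)%N]mulnC !exprM.
rewrite (prim_expr_order z_prim) !expr1n invr1 mulr1 subrr mulf_eq0.
by rewrite (negPf w_neq1) => /eqP ->; rewrite mulr0.
Qed.

Lemma conv_characters (u v : nat -> F) : b%:R != 0 :> F ->
  conv b (fun n => b%:R^-1 * \sum_(1 <= j < b) z ^ (j%:Z * n) * u j)
         (fun n => b%:R^-1 * \sum_(1 <= j < b) z ^ (j%:Z * n) * v j)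
  = fun n => b%:R^-1 * \sum_(1 <= j < b) z ^ (j%:Z * n) * (u j * v j).
Proof.
move=> b_neq0; apply: funext => t; rewrite /conv.
under eq_bigr => m _ do rewrite mulrACA big_distrlr /=.
rewrite -mulr_sumr -mulrA; congr (_ * _).
(* Summing over [m] first leaves only the diagonal k = j; the factor [b] it yields cancels one of
   the two normalisations 1/b. *)
rewrite exchange_big_nat mulr_sumr !big_nat; apply: eq_bigr => j.
case/andP=> j_gt0 ltjb; rewrite exchange_big_nat /=.
have termE k : (1 <= k < b)%N ->
    \sum_(0 <= m < b) z ^ (j%:Z * (t - m%:Z)) * u j * (z ^ (k%:Z * m%:Z) * v k)
    = if j == k then b%:R * z ^ (j%:Z * t) * (u j * v k) else 0.
  case/andP=> _ ltkb; under eq_bigr => m _ do rewrite mulrACA.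
  rewrite -mulr_suml prim_root_orthogonality //.
  by case: ifP; rewrite ?mul0r.
rewrite (eq_big_nat _ _ termE).
rewrite (bigD1_seq j) ?mem_index_iota ?iota_uniq ?eqxx ?j_gt0 //=.
rewrite big1 => [|k]; last by rewrite eq_sym => /negPf->.
by rewrite addr0 -mulrA mulKf.
Qed.

End PrimitiveRoot.

Section FourierDedekind.
Variables (R : realType) (b : nat).
Hypothesis b_gt0 : (0 < b)%N.

(** The j-th coefficients are inverses of products over the lists, and inversion is multiplicative
    even at 0, where the inverse is 0. *)
Lemma fourier_dedekind_conv (s1 s2 : seq nat) :
  conv b (fourier_dedekind R s1 b) (fourier_dedekind R s2 b)
    = fourier_dedekind R (s1 ++ s2) b.
Proof.
rewrite /fourier_dedekind (conv_characters _ _ _ (xi_prim R b b_gt0)); last first.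
  by rewrite pnatr_eq0 -lt0n.
apply: funext => n; congr (_ * _); apply: eq_bigr => j _.
by rewrite big_cat /= invfM.
Qed.

(** The accumulator of the fold is kept general, as the sum over [s1], so that induction on [s2]
    goes through. *)
Lemma foldl_conv_fourier_dedekind (s1 s2 : seq nat) :
  foldl (conv b) (fourier_dedekind R s1 b)
    [seq fourier_dedekind R [:: ai] b | ai <- s2]
  = fourier_dedekind R (s1 ++ s2) b.
Proof.
elim: s2 s1 => [|c s2 IHs2] s1 /=; first by rewrite cats0.
by rewrite fourier_dedekind_conv IHs2 -catA.
Qed.

Lemma fourier_dedekind_sub_translate (s : seq nat) (c : nat) : coprime c b ->
  (idfun \- translate c%:Z) (fourier_dedekind R (rcons s c) b)
    = fourier_dedekind R s b.
Proof.
move=> co_cb; have z_prim := xi_prim R b b_gt0.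
apply: funext => n; rewrite /translate /fourier_dedekind /=.
rewrite -[LHS]mulrBr -sumrB; congr (_ * _).
rewrite !big_nat; apply: eq_bigr => j /andP[j_gt0 ltjb].
(* Otherwise [b] divides [j * c], hence [j] by coprimality, against 0 < j < b. This factor, produced
   by I - T^c, then cancels the one that [c] adds to the denominator. *)
have den_neq0 : 1 - xi R b ^+ (j * c) != 0.
  rewrite subr_eq0 eq_sym -(prim_order_dvd z_prim) Gauss_dvdl 1?coprime_sym //.
  by rewrite gtnNdvd.
rewrite -mulrBl mulrDr expfzDr ?(prim_root_neq0 _ _ _ z_prim) //.
rewrite big_rcons /= -PoszM -exprnP -[X in X - _]mulr1 -mulrBr invfM mulrA.
by rewrite mulrAC mulfK // mulrAC.
Qed.

End FourierDedekind.

Theorem theorem3 (R : realType) (b d : nat) (a : d.-tuple nat)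
    (hb : (2 <= b)%N) (hd : (1 <= d)%N)
    (ha : forall i : 'I_d, (0 < tnth a i)%N /\ coprime (tnth a i) b) :
  (idfun \- translate (nth 0%N a d.-1)%:Z) (fourier_dedekind R a b)
    = fourier_dedekind R (take d.-1 a) b
  /\
  fourier_dedekind R a b = convs b [seq fourier_dedekind R [:: ai] b | ai <- a].
Proof.
have b_gt0 : (0 < b)%N := ltnW hb.
have lt_last : (d.-1 < d)%N by rewrite prednK.
split.
  (* Since d >= 1, the index [d.-1] is in range, so [nth] gives a_d and not its default 0. *)
  have aE : rcons (take d.-1 a) (nth 0%N a d.-1) = a.
    by rewrite -take_nth ?size_tuple // prednK // take_oversize ?size_tuple.
  have [_] := ha (Ordinal lt_last); rewrite (tnth_nth 0%N) => co_last.
  by rewrite -[in RHS](fourier_dedekind_sub_translate _ _ b_gt0 _ _ co_last) aE.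
(* For a nonempty list [convs] starts folding at its head, which is the accumulator [[:: c]]. *)
case: a ha => [[|c s] /= size_s] _; first by rewrite -(eqP size_s) in hd.
by rewrite foldl_conv_fourier_dedekind.
Qed.
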